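(* Let $X$ be a topological space and let $K_1,K_2\subset X$ be parallel $L$-retracts of $X$. Then the $\mathbb{R}$-quotient mappings $p_1: X\to X/K_1$ and $p_2: X\to X/K_2$ are $L$-equivalent. In particular, the spaces $X/K_1$ and $X/K_2$ are $L$-equivalent.
   Context: All topological spaces are Tychonoff ($T_1$ and completely regular); all locally convex spaces are real and Hausdorff. The free locally convex space $L(X)$ over $X$ is a locally convex space with a continuous injection $\delta_X: X\to L(X)$ such that $L(X)$ is the linear span of $\delta_X(X)$ and every continuous $f: X\to E$ to a locally convex space $E$ satisfies $f=f_\#\circ\delta_X$ for a (unique) continuous linear $f_\#: L(X)\to E$. It exists and is unique up to topological isomorphism, $\delta_X$ is a closed topological embedding, and $\delta_X(X)$ is a Hamel basis; $X$ is identified with $\delta_X(X)$. For continuous $f: X\to Y$, $f_\#: L(X)\to L(Y)$ also denotes the continuous linear extension of $f$. For $K\subset X$, $L(K)$ (with its own free topology) is identified as a vector space with the linear span of $K$ in $L(X)$; $K$ is $L$-embedded in $X$ if the topology of $L(K)$ is the subspace topology from $L(X)$. $K$ is an $L$-retract of $X$ if $K$ is $L$-embedded in $X$ and there is a continuous linear retraction $r: L(X)\to L(K)$ (that is, $r$ is the identity on $L(K)$). Every $L$-retract is closed. Two $L$-retracts $K_1,K_2$ of $X$ are parallel if there are continuous linear retractions $r_1: L(X)\to L(K_1)$ and $r_2: L(X)\to L(K_2)$ with $r_1\circ r_2=r_1$ and $r_2\circ r_1=r_2$. A continuous surjection $p: X\to Y$ is $\mathbb{R}$-quotient if every function $f: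 Y\to\mathbb{R}$ with $f\circ p$ continuous is continuous. For a nonempty closed $K\subset X$, $X/K=(X\setminus K)\cup\{K\}$, and the natural mapping $p: X\to X/K$ is $p(x)=x$ for $x\in X\setminus K$, $p(x)=K$ for $x\in K$; $X/K$ carries the unique completely regular topology making $p$ an $\mathbb{R}$-quotient mapping (this space is Tychonoff). Spaces $X,Y$ are $L$-equivalent if $L(X)$ and $L(Y)$ are topologically isomorphic (linearly homeomorphic). Continuous mappings $f: X\to Y$ and $g: Z\to T$ are $L$-equivalent if there are topological isomorphisms $\varphi: L(X)\to L(Z)$ and $\psi: L(Y)\to L(T)$ with $\psi\circ f_\#=g_\#\circ\varphi$. *)

(* Defs.v *)
From HB Require Import structures.
From mathcomp Require Import all_boot all_order all_algebra finmap.
From mathcomp Require Import all_classical all_reals all_analysis.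
From mathcomp Require Import ring lra.

Set Implicit Arguments.
Unset Strict Implicit.
Unset Printing Implicit Defensive.

Import Order.TTheory GRing.Theory Num.Theory.
Import numFieldNormedType.Exports.

Local Open Scope classical_set_scope.
Local Open Scope ring_scope.

Definition tychonoff_space (X : topologicalType) : Prop :=
  accessible_space X /\ completely_regular_space X.

(** * Free locally convex spaces *)

(* [tvsType R] is the type of locally convex spaces over [R]; they are not
   assumed to be Hausdorff, whence the explicit separation hypotheses. *)
Record is_free_lcs (R : realType) (X : topologicalType) (L : tvsType R)
    (delta : X -> L) : Prop := IsFreeLcs {
  free_hausdorff : hausdorff_space L;
  free_delta_continuous : continuous delta;
  free_delta_inj : injective delta;
  free_span : forall v : L,
    exists s : seq (R * X), v = \sum_(a <- s) a.1 *: delta a.2;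
  free_extension : forall (E : tvsType R) (f : X -> E),
    hausdorff_space E -> continuous f ->
    exists2 g : {linear L -> E}, continuous g & forall x, g (delta x) = f x
}.

Structure freeLcs (R : realType) (X : topologicalType) := FreeLcs {
  free_sort :> tvsType R;
  delta : X -> free_sort;
  freeP : is_free_lcs delta
}.

Arguments delta {R X} f x : rename.

Section lcs_map.
Context (R : realType) (X Y : topologicalType).
Context (LX : freeLcs R X) (LY : freeLcs R Y) (f : continuousType X Y).

Lemma lcs_map_subproof : exists2 g : {linear LX -> LY},
  continuous g & forall x, g (delta LX x) = delta LY (f x).
Proof.
apply: (free_extension (freeP LX)); first exact: free_hausdorff (freeP LY).
move=> x; apply: continuous_comp; first exact: cts_fun.
exact: free_delta_continuous (freeP LY) _.
Qed.

(* The continuous linear extension [f_# : L(X) -> L(Y)] of [f : X -> Y]. *)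
Definition lcs_map : {linear LX -> LY} := s2val (cid2 lcs_map_subproof).

Lemma lcs_map_continuous : continuous lcs_map.
Proof. exact: s2valP (cid2 lcs_map_subproof). Qed.

Lemma lcs_map_delta x : lcs_map (delta LX x) = delta LY (f x).
Proof. exact: s2valP' (cid2 lcs_map_subproof) x. Qed.

Lemma lcs_map_unique (g : {linear LX -> LY}) :
  (forall x, g (delta LX x) = delta LY (f x)) -> g =1 lcs_map.
Proof.
move=> gE v; have [s ->] := free_span (freeP LX) v.
rewrite !linear_sum; apply: eq_bigr => a _.
by rewrite !linearZ gE lcs_map_delta.
Qed.

End lcs_map.

Definition top_iso (R : realType) (E F : tvsType R) (phi : {linear E -> F}) :=
  continuous phi /\
  exists psi : F -> E, [/\ cancel phi psi, cancel psi phi & continuous psi].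

(** * L-retracts *)

Section set_val_continuous.
Context (X : topologicalType) (K : set X).

Lemma set_val_continuous : continuous (set_val : K -> X).
Proof. exact: initial_continuous. Qed.

HB.instance Definition _ := isContinuous.Build K X set_val set_val_continuous.

End set_val_continuous.

Section L_retract.
Context (R : realType) (X : topologicalType) (LX : freeLcs R X).

(* The map identifying [L(K)] with the linear span of [K] in [L(X)]. *)
Definition L_incl (K : set X) (LK : freeLcs R K) : {linear LK -> LX} :=
  lcs_map LK LX (set_val : K -> X).

Definition L_embedded (K : set X) (LK : freeLcs R K) : Prop :=
  forall U : set LK, open U <-> exists2 V : set LX, open V & U = L_incl LK @^-1` V.

Definition L_retraction (K : set X) (LK : freeLcs R K) (r : {linear LX -> LK}) :=
  continuous r /\ forall v : LK, r (L_incl LK v) = v.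

Definition L_retract (K : set X) (LK : freeLcs R K) : Prop :=
  L_embedded LK /\ exists r : {linear LX -> LK}, L_retraction r.

Definition parallel_L_retracts (K1 K2 : set X)
    (LK1 : freeLcs R K1) (LK2 : freeLcs R K2) : Prop :=
  [/\ L_retract LK1, L_retract LK2 &
    exists (r1 : {linear LX -> LK1}) (r2 : {linear LX -> LK2}),
      [/\ L_retraction r1, L_retraction r2,
          forall v : LX, r1 (L_incl LK2 (r2 v)) = r1 v &
          forall v : LX, r2 (L_incl LK1 (r1 v)) = r2 v]].

End L_retract.

(** * The quotient space X/K *)

Definition R_quotient (R : realType) (X Y : topologicalType) (p : X -> Y) :=
  [/\ continuous p, (forall y, exists x, p x = y) &
      forall f : Y -> R, continuous (f \o p) -> continuous f].

(* [None] is the point [K] of [X/K], so that this is only meaningful when [K] is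
   nonempty. The field [R] does not occur in the type but determines the topology. *)
Definition collapse (R : realType) (X : topologicalType) (K : set X) : Type :=
  option (~` K).

Section collapse.
Context (R : realType) (X : topologicalType) (K : set X).

HB.instance Definition _ := Choice.on (collapse R K).

Definition collapse_proj (x : X) : collapse R K := (insub x : option (~` K)).

Lemma collapse_proj_in x : K x -> collapse_proj x = None.
Proof. by move=> Kx; rewrite /collapse_proj insubF// in_setC mem_set. Qed.

Lemma collapse_proj_out (x : ~` K) : collapse_proj (\val x) = Some x.
Proof. exact: valK. Qed.

(* The coarsest topology for which every [f : X/K -> R] with [f \o p] continuous
   is continuous. By [collapse_proj_R_quotient] and [collapse_topology_unique]
   below, it is the unique completely regular topology making the projection
   [R]-quotient. *)
HB.instance Definition _ := Uniform.copy (collapse R K)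
  (sup_topology
    (fun f : {f : option (~` K) -> R | continuous (f \o collapse_proj)} =>
       Uniform.class (initial_topology (sval f)))).

Lemma collapse_proj_continuous : continuous collapse_proj.
Proof.
move=> x; apply/cvg_sup => -[f cf] A /= [_ [[B oB <-] Bx] BA].
rewrite nbhs_filterE; apply: filterS BA _.
by apply: (cf x); exact: open_nbhs_nbhs.
Qed.

HB.instance Definition _ :=
  isContinuous.Build X (collapse R K) collapse_proj collapse_proj_continuous.

Lemma collapse_functionP (f : collapse R K -> R) :
  continuous f <-> continuous (f \o collapse_proj).
Proof.
split=> cf.
  by move=> x; apply: continuous_comp; [exact: collapse_proj_continuous|exact: cf].
move=> y A /(@initial_continuous _ _ (f : option (~` K) -> R) y) fA.
have yy : nbhs y --> y by [].
by move/cvg_sup: yy => /(_ (exist _ f cf)); apply.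
Qed.

Lemma collapse_proj_R_quotient : K !=set0 -> R_quotient R collapse_proj.
Proof.
move=> [x0 Kx0]; split; first exact: collapse_proj_continuous.
  case=> [x|]; last by exists x0; exact: collapse_proj_in.
  by exists (\val x); exact: collapse_proj_out.
by move=> f /collapse_functionP.
Qed.

Lemma collapse_completely_regular : completely_regular_space (collapse R K).
Proof. exact: (@uniform_completely_regular R). Qed.

End collapse.

(** * L-equivalence *)

(* Free locally convex spaces over a given space are unique up to topological
   isomorphism, so these notions do not depend on the chosen realizations; those
   of a Tychonoff space exist by [freeLcs_exists] below. *)

Definition L_equivalent (R : realType) (X Y : topologicalType)
    (LX : freeLcs R X) (LY : freeLcs R Y) : Prop :=
  exists phi : {linear LX -> LY}, top_iso phi.

Definition L_equivalent_maps (R : realType) (X Y Z T : topologicalType)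
    (LX : freeLcs R X) (LY : freeLcs R Y) (LZ : freeLcs R Z) (LT : freeLcs R T)
    (f : continuousType X Y) (g : continuousType Z T) : Prop :=
  exists (phi : {linear LX -> LZ}) (psi : {linear LY -> LT}),
    [/\ top_iso phi, top_iso psi &
        forall v : LX, psi (lcs_map LX LY f v) = lcs_map LZ LT g (phi v)].

(** * Facts on X/K *)

Lemma continuous_real_functions (R : realType) (Y Z : topologicalType)
    (h : Y -> Z) :
  completely_regular_space Z ->
  (forall g : Z -> R, continuous g -> continuous (g \o h)) -> continuous h.
Proof.
move=> crZ gh y A; rewrite nbhsE => -[V [oV Vy] VA].
have clV : closed (~` V) by exact: open_closedC.
have nV : ~ (~` V) (h y) by exact.
have /(@uniform_separatorP _ R)[g [cg _ g0 g1]] := crZ _ _ clV nV.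
have ghy : g (h y) = 0 by apply: g0; exists (h y).
have /(gh g cg y) : nbhs ((g \o h) y) [set r : R | r < 1].
  by rewrite /= ghy; apply: open_nbhs_nbhs; split; [exact: open_lt|exact: ltr01].
rewrite nbhs_filterE => gy1.
rewrite nbhs_filterE; apply: (@filterS _ (nbhs y) _ _ _ _ gy1) => z /= gz1; apply: VA; apply: contrapT => nVz.
by move: gz1; rewrite (_ : g (h z) = 1) ?ltxx//; apply: g1; exists (h z).
Qed.

Section collapse_facts.
Context (R : realType) (X : topologicalType) (K : set X).

Lemma collapse_topology_unique (Y : topologicalType) (q : X -> Y)
    (h : collapse R K -> Y) (k : Y -> collapse R K) :
  K !=set0 -> completely_regular_space Y -> R_quotient R q ->
  cancel h k -> cancel k h -> (forall x, h (collapse_proj R K x) = q x) ->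
  continuous h /\ continuous k.
Proof.
move=> K0 crY [cq _ Rq] hk kh hq; split.
  apply: (@continuous_real_functions R) => // g cg.
  apply/collapse_functionP => x.
  rewrite (_ : _ \o _ = g \o q); last by apply/funext => z /=; rewrite hq.
  by apply: continuous_comp; [exact: cq|exact: cg].
apply: (@continuous_real_functions R) => [|g cg].
  exact: collapse_completely_regular.
apply: Rq; rewrite (_ : _ \o _ = g \o collapse_proj R K).
  exact/collapse_functionP.
by apply/funext => z /=; rewrite -hq hk.
Qed.

Lemma collapse_tychonoff : tychonoff_space X -> closed K ->
  tychonoff_space (collapse R K).
Proof.
move=> [T1 crX] clK; split; last exact: collapse_completely_regular.
have sep (a : X) (y : collapse R K) : ~ K a -> y != collapse_proj R K a ->
    exists g : collapse R K -> R, [/\ continuous g,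
      g (collapse_proj R K a) = 0 & g y = 1].
  move=> nKa ya.
  pose B : set X := [set b | collapse_proj R K b = y] `|` K.
  have clB : closed B.
    case: y ya @B => [y|] ya B; last first.
      suff -> : B = K by [].
      apply/seteqP; split=> [z [|//]|z Kz]; last by right.
      move=> /= zN; apply: contrapT => nKz.
      by have := collapse_proj_out R (exist _ z (mem_set nKz)); rewrite zN.
    suff -> : B = \val y |` K.
      by apply: closedU => //; exact: accessible_closed_set1.
    apply/seteqP; split=> z [/=zy|Kz]; [left|by right|left|by right].
      have [Kz|nKz] := pselect (K z); first by move: zy; rewrite collapse_proj_in.
      move: zy; rewrite (collapse_proj_out R (exist _ z (mem_set nKz))).
      by case=> <-.
    by rewrite zy; exact: collapse_proj_out.
  have nBa : ~ B a by case=> // /esym/eqP; rewrite (negbTE ya).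
  have /(@uniform_separatorP _ R)[f [cf _ f0 f1]] := crX _ _ clB nBa.
  have fK b : K b -> f b = 1 by move=> Kb; apply: f1; exists b => //; right.
  pose g (z : collapse R K) : R := if z is Some z' then f (\val z') else 1.
  have gE : g \o collapse_proj R K = f.
    apply/funext => z /=; have [Kz|nKz] := pselect (K z).
      by rewrite collapse_proj_in// fK.
    by rewrite (collapse_proj_out R (exist _ z (mem_set nKz))).
  exists g; split; first by apply/collapse_functionP; rewrite gE.
    by rewrite -[LHS]/((g \o collapse_proj R K) a) gE; apply: f0; exists a.
  case: y {ya nBa} @B f1 {clB} => [y|] //= f1.
  by apply: f1; exists (\val y) => //; left; exact: collapse_proj_out.
move=> x y xy.
have sep2 (c : R) (g : collapse R K -> R) : continuous g ->
   open [set z | g z < c] /\ open [set z | c < g z].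
  move=> cg; split.
    by apply: (@open_comp _ _ g [set r | r < c]) => [z _|]; [exact: cg|exact: open_lt].
  by apply: (@open_comp _ _ g [set r | c < r]) => [z _|]; [exact: cg|exact: open_gt].
have h0 : 0 < 2^-1 :> R by rewrite invr_gt0.
have h1 : 2^-1 < 1 :> R by rewrite invf_lt1// ltr1n.
case: x xy => [x|] xy.
  have nKx : ~ K (\val x) by exact: set_mem (valP x).
  have [|g [cg gx gy]] := sep (\val x) y nKx.
    by rewrite collapse_proj_out eq_sym.
  rewrite collapse_proj_out in gx.
  exists [set z | g z < 2^-1]; split; first exact: (sep2 _ _ cg).1.
    by rewrite inE /= gx.
  by rewrite inE /= gy => /(lt_trans h1); rewrite ltxx.
case: y xy => [y|//] xy.
have nKy : ~ K (\val y) by exact: set_mem (valP y).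
have [|g [cg gy gx]] := sep (\val y) None nKy; first by rewrite collapse_proj_out.
rewrite collapse_proj_out in gy.
exists [set z | 2^-1 < g z]; split; first exact: (sep2 _ _ cg).2.
  by rewrite inE /= gx.
by rewrite inE /= gy => /(lt_trans h0); rewrite ltxx.
Qed.

End collapse_facts.

(** * Existence of free locally convex spaces *)

Module FreeLcsExistence.

Section carrier.
Context (R : realType) (X : topologicalType).

Definition supp (f : X -> R^o) : set X := [set x | f x != 0].

Definition fsupp : {pred (X -> R^o)} := fun f => `[< finite_set (supp f) >].

Lemma fsupp_submod_closed : submod_closed fsupp.
Proof.
split.
  apply/asboolP; rewrite (_ : supp _ = set0)//.
  by apply/seteqP; split=> x //=; rewrite /supp /= eqxx.
move=> c f g /asboolP ff /asboolP fg; apply/asboolP.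
apply: (@sub_finite_set _ _ (supp f `|` supp g)); last by rewrite finite_setU.
move=> x; rewrite /supp /= => cfg; apply: contrapT => /not_orP[].
move=> /negP; rewrite negbK => /eqP fx /negP; rewrite negbK => /eqP gx.
move: cfg; rewrite -[(c *: f + g) x]/(c *: f x + g x) fx gx.
by rewrite scaler0 addr0 eqxx.
Qed.

HB.instance Definition _ :=
  GRing.isSubmodClosed.Build _ _ fsupp fsupp_submod_closed.

Definition carrier : Type := {f : X -> R^o | f \in fsupp}.

HB.instance Definition _ := SubChoice.on carrier.
HB.instance Definition _ := [SubChoice_isSubLmodule of carrier by <:].

Implicit Types v w : carrier.

Lemma finite_supp v : finite_set (supp (\val v)).
Proof. exact/asboolP/(valP v). Qed.

Lemma fdelta_subproof (x : X) : (fun y => (y == x)%:R : R^o) \in fsupp.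
Proof.
apply/asboolP; apply: (@sub_finite_set _ _ [set x]) => // y.
by rewrite /supp /=; case: (y =P x) => // _; rewrite mulr0n eqxx.
Qed.

Definition fdelta (x : X) : carrier := 
  exist (fun f => f \in fsupp) _ (fdelta_subproof x).

Lemma fdeltaE x y : \val (fdelta x) y = (y == x)%:R. Proof. by []. Qed.

Lemma supp_fdelta x : supp (\val (fdelta x)) `<=` [set x].
Proof.
by move=> y; rewrite /supp /mkset fdeltaE; case: (y =P x) => // _; rewrite mulr0n eqxx.
Qed.

Section extension.
Context (E : lmodType R) (f : X -> E).

Definition ext v : E := \sum_(x <- fset_set (supp (\val v))) \val v x *: f x.

Lemma extE (A : set X) v : finite_set A -> supp (\val v) `<=` A ->
  ext v = \sum_(x <- fset_set A) \val v x *: f x.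
Proof.
move=> fA vA; rewrite /ext.
rewrite [RHS](bigID (fun x => \val v x != 0))/=.
rewrite [X in _ + X]big1 ?addr0; last first.
  by move=> x; rewrite negbK => /eqP ->; rewrite scale0r.
rewrite -[RHS]big_filter; apply: perm_big; apply: uniq_perm.
- exact: fset_uniq.
- by rewrite filter_uniq// fset_uniq.
move=> x; rewrite mem_filter !in_fset_set//; last exact: finite_supp.
apply/idP/andP => [/set_mem xv|[xv _]]; last exact: mem_set.
by split=> //; apply: mem_set; exact: vA.
Qed.

Lemma ext_is_linear : linear ext.
Proof.
move=> c v w; pose A := supp (\val v) `|` supp (\val w).
have fA : finite_set A by rewrite finite_setU; split; exact: finite_supp.
rewrite !(@extE A)//.
- rewrite scaler_sumr -big_split/=; apply: eq_bigr => x _.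
  by rewrite scalerA -scalerDl.
- by move=> x; right.
- by move=> x; left.
move=> x; rewrite /supp /= => cfg; apply: contrapT => /not_orP[].
move=> /negP; rewrite negbK => /eqP fx /negP; rewrite negbK => /eqP gx.
move: cfg; rewrite -[X in X != 0]/(c * \val v x + \val w x).
by rewrite fx gx mulr0 addr0 eqxx.
Qed.

HB.instance Definition _ :=
  GRing.isLinear.Build R carrier E *:%R ext ext_is_linear.

Lemma ext_delta x : ext (fdelta x) = f x.
Proof.
rewrite (@extE [set x])//; last exact: supp_fdelta.
by rewrite fset_set1 big_seq_fset1 fdeltaE eqxx scale1r.
Qed.

End extension.

Lemma carrier_span v : v = ext fdelta v.
Proof.
apply/val_inj/funext => x.
rewrite /ext raddf_sum fct_sumE /=.
rewrite (eq_bigr (fun y => \val v y * (x == y)%:R)); last by [].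
have [vx|vx] := eqVneq (\val v x) 0.
  rewrite big1 ?vx// => y _; have [<-|] := eqVneq x y; first by rewrite vx mul0r.
  by rewrite mulr0.
rewrite (big_fsetD1 x)/=; last by rewrite in_fset_set ?inE//; exact: finite_supp.
rewrite eqxx mulr1 big1_fset ?addr0// => y.
by rewrite in_fsetD1 eq_sym => /andP[/negPf -> _]; rewrite mulr0.
Qed.

(* The convex symmetric absorbing sets whose translates by [fdelta y] pull back
   to neighborhoods of [y], at every scale. *)
Definition admissible (U : set carrier) : Prop :=
  [/\ (forall a b t, 0 <= t <= 1 -> U a -> U b -> U (t *: a + (1 - t) *: b)),
      (forall a, U a -> U (- a)),
      (forall v, exists2 r : R, 0 < r & forall t, `|t| <= r -> U (t *: v)) &
      (forall (r : R) y, \forall x \near y, U (r *: (fdelta x - fdelta y)))].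

Lemma admissible0 U : admissible U -> U 0.
Proof.
by case=> _ _ /(_ 0)[r r0 /(_ 0)]; rewrite normr0 scaler0 => + _; apply; exact: ltW.
Qed.

Lemma admissible_balanced U a t : admissible U -> `|t| <= 1 -> U a -> U (t *: a).
Proof.
move=> aU t1 Ua; have U0 := admissible0 aU; case: aU => cU sU _ _.
have pos s : 0 <= s <= 1 -> U (s *: a).
  by move=> s01; have := cU a 0 s s01 Ua U0; rewrite scaler0 addr0.
have [t0|t0] := leP 0 t; first by apply: pos; rewrite t0 -(ger0_norm t0).
rewrite -[t]opprK scaleNr; apply: sU; apply: pos.
by rewrite -(ltr0_norm t0) normr_ge0.
Qed.

Lemma admissible_half U a b : admissible U ->
  U (2 *: a) -> U (2 *: b) -> U (a + b).
Proof.
case=> cU _ _ _ Ua Ub; have := cU _ _ 2^-1 _ Ua Ub.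
rewrite !scalerA (_ : (1 - 2^-1) * 2 = 1); last by field.
rewrite mulVf ?pnatr_eq0// !scale1r; apply.
by apply/andP; split; lra.
Qed.

Lemma admissibleI U V : admissible U -> admissible V -> admissible (U `&` V).
Proof.
move=> [cU sU aU nU] [cV sV aV nV]; split.
- by move=> a b t t01 [Ua Va] [Ub Vb]; split; [exact: cU|exact: cV].
- by move=> a [Ua Va]; split; [exact: sU|exact: sV].
- move=> v; have [r r0 rU] := aU v; have [s s0 sV'] := aV v.
  exists (Num.min r s) => [|t]; first by rewrite lt_min r0.
  by rewrite le_min => /andP[tr ts]; split; [exact: rU|exact: sV'].
- by move=> r y; apply: filterI; [exact: nU|exact: nV].
Qed.

Lemma admissibleZ U c : admissible U -> admissible [set v | U (c *: v)].
Proof.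
move=> aU'; have := aU' => -[cU sU aU nU]; split.
- move=> a b t t01 /= Ua Ub; have := cU _ _ t t01 Ua Ub.
  by rewrite scalerDr !scalerA ![_ * c]mulrC.
- by move=> a /= /sU; rewrite scalerN.
- move=> v; have [r r0 rU] := aU (c *: v); exists r => // t /rU.
  by rewrite /= !scalerA mulrC.
- by move=> r y; apply: filterS (nU (c * r) y) => x; rewrite /= scalerA.
Qed.

Definition fnbhs (v : carrier) : set_system carrier :=
  [set N | exists2 U, admissible U & forall w, U (w - v) -> N w].

HB.instance Definition _ := hasNbhs.Build carrier fnbhs.

Lemma admissibleT : admissible setT.
Proof. by split=> // [v|r y]; [exists 1|exact: filterT]. Qed.

Lemma fnbhs_filter v : ProperFilter (nbhs v).
Proof.
apply: Build_ProperFilter_ex.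
  by move=> N [U aU UN]; exists v; apply: UN; rewrite subrr; exact: admissible0.
split; first by exists setT => //; exact: admissibleT.
  move=> N M [U aU UN] [V aV VM]; exists (U `&` V); first exact: admissibleI.
  by move=> w [/UN ? /VM].
by move=> N M NM [U aU UN]; exists U => // w /UN /NM.
Qed.

Lemma fnbhs_singleton v N : nbhs v N -> N v.
Proof. by move=> [U aU]; apply; rewrite subrr; exact: admissible0. Qed.

Lemma fnbhs_nbhs v N : nbhs v N -> nbhs v (nbhs^~ N).
Proof.
move=> [U aU UN]; exists [set w | U (2 *: w)] => [|w Uw].
  exact: admissibleZ.
exists [set w | U (2 *: w)] => [|z Uz]; first exact: admissibleZ.
by apply: UN; rewrite -(subrKA w z (- v)); apply: admissible_half.
Qed.

HB.instance Definition _ := Nbhs_isNbhsTopological.Build carrier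
  fnbhs_filter fnbhs_singleton fnbhs_nbhs.

Lemma nbhs_admissible v U : admissible U -> nbhs v [set w | U (w - v)].
Proof. by move=> aU; exists U. Qed.

Lemma fadd_continuous : continuous (fun x : carrier * carrier => x.1 + x.2).
Proof.
move=> [a b] N /= [U aU UN].
exists ([set w | U (2 *: (w - a))], [set w | U (2 *: (w - b))]); rewrite /=.
  by split; apply: (nbhs_admissible _ (admissibleZ 2 aU)).
move=> [w z] [/= Uw Uz]; apply: UN.
by rewrite opprD addrACA; exact: admissible_half.
Qed.

Lemma fscale_continuous : continuous (fun z : R^o * carrier => z.1 *: z.2).
Proof.
move=> [t v] N /= [U aU UN].
have [_ _ /(_ (2 *: v))[r r0 rU] _] := aU.
pose M := `|t| + 1.
have M0 : 0 < M by rewrite ltr_wpDl.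
exists ([set s : R^o | `|s - t| < Num.min 1 r],
        [set w | U ((2 * M) *: (w - v))]); rewrite /=.
  split; last exact: (nbhs_admissible _ (admissibleZ _ aU)).
  apply/nbhs_ballP; exists (Num.min 1 r) => /=; first by rewrite lt_min ltr01.
  by move=> s; rewrite /ball/= distrC.
move=> [s w] [/=]; rewrite lt_min => /andP[s1 sr] Uw; apply: UN.
rewrite (_ : _ - _ = s *: (w - v) + (s - t) *: v); last first.
  by rewrite scalerBr scalerBl subrKA.
apply: admissible_half => //; last first.
  by rewrite scalerA mulrC -scalerA; apply: rU; exact: ltW.
rewrite (_ : 2 *: _ = (s / M) *: ((2 * M) *: (w - v))); last first.
  by rewrite !scalerA; congr (_ *: _); field; rewrite gt_eqF.
apply: admissible_balanced => //.
rewrite normrM normfV (gtr0_norm M0) ler_pdivrMr// mul1r /M.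
by rewrite -[s](subrK t) (le_trans (ler_normD _ _))// addrC lerD2l ltW.
Qed.

Lemma interior_admissible U v : admissible U ->
  convex_set ([set w | U (w - v)]°).
Proof.
move=> aU; have := aU => -[cU _ _ _].
move=> a b l /set_mem [/= V aV VU] /set_mem [/= W aW WU]; apply/mem_set.
exists (V `&` W) => [|z [Vz Wz]]; first exact: admissibleI.
rewrite /=; set d := z - _ in Vz Wz.
have Ua : U (a + d - v) by apply: VU; rewrite addrAC subrr add0r.
have Ub : U (b + d - v) by apply: WU; rewrite addrAC subrr add0r.
have l01 : 0 <= l%:num <= 1 by apply/andP; split.
have := cU _ _ l%:num l01 Ua Ub; congr U.
have -> : z = l%:num *: a + (1 - l%:num) *: b + d by rewrite addrC subrK.
clearbody d; rewrite -!addrA; move: (d - v) => e.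
by rewrite !scalerDr addrACA -scalerDl [l%:num + _]addrC subrK scale1r !addrA.
Qed.

Lemma flocally_convex : exists2 B : set_system carrier,
  (forall b, b \in B -> convex_set b) & basis B.
Proof.
exists [set b | open b /\ convex_set b]; first by move=> b /set_mem[].
split=> [b []//|v N [U aU UN]].
exists ([set w | U (w - v)]°).
  split; first by split; [exact: open_interior|exact: interior_admissible].
  exact: nbhs_admissible.
by move=> w /interior_subset /UN.
Qed.

HB.instance Definition _ :=
  PreTopologicalNmodule_isTopologicalNmodule.Build carrier fadd_continuous.
HB.instance Definition _ :=
  TopologicalNmodule_isTopologicalLmodule.Build R carrier fscale_continuous.
HB.instance Definition _ := PreTopologicalLmod_isTvs.Build R carrier
  fadd_continuous fscale_continuous flocally_convex.
HB.instance Definition _ := Uniform_isTvs.Build R carrier flocally_convex.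

Lemma fdelta_continuous : continuous fdelta.
Proof.
move=> x N [U aU UN]; have [_ _ _ /(_ 1 x)] := aU.
by apply: filterS => y; rewrite scale1r; exact: UN.
Qed.

Lemma fdelta_inj : injective fdelta.
Proof.
move=> x y /(congr1 (fun v => \val v x)); rewrite !fdeltaE eqxx => /eqP.
by have [//|_] := eqVneq x y; rewrite mulr0n oner_eq0.
Qed.

Lemma ext_continuous (E : tvsType R) (f : X -> E) :
  continuous f -> continuous (ext f : carrier -> E).
Proof.
move=> cf v N Nv; rewrite nbhs_filterE.
have [B cB [oB bB]] := @locally_convex R E.
have : nbhs (0 : E) [set e | N (e + ext f v)].
  have := @add_continuous E (0, ext f v) N; rewrite /= add0r => /(_ Nv).
  move=> [[A C]/= [A0 Cv] AC]; apply: filterS A0 => e Ae.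
  by apply: (AC (e, _)); split => //=; exact: nbhs_singleton.
move=> /(bB 0)[W [BW W0] WN].
have cW := cB _ (mem_set BW); have Wnear := open_nbhs_nbhs (conj (oB _ BW) W0).
pose U : set carrier := [set a | W (ext f a) /\ W (- ext f a)].
have nsub : \forall e \near (0 : E), W e /\ W (- e).
  apply: filterI; first exact: Wnear.
  by have := @opp_continuous E 0 W; rewrite oppr0; apply.
have sc0 (e : E) : (fun t : R^o => t *: e) @ (0 : R^o) --> (0 : E).
  apply: (@cvg_comp _ _ _ (fun t : R^o => (t, e)) (fun z : R^o * E => z.1 *: z.2)
    _ (nbhs ((0 : R^o), e))).
    by apply: (@cvg_pair _ _ _ _ (nbhs (0 : R^o)) (nbhs e));
      [exact: cvg_id|exact: cvg_cst].
  by have := @scale_continuous R E (0, e); rewrite /continuous_at /= scale0r.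
exists U; last first.
  by move=> w [+ _]; rewrite linearB => /WN /=; rewrite subrK.
split.
- move=> a b t /andP[t0 t1] [Wa Wa'] [Wb Wb'].
  have conv x y : W x -> W y -> W (t *: x + (1 - t) *: y).
    move=> Wx Wy.
    have := cW x y (Itv01 t0 t1) (mem_set Wx) (mem_set Wy).
    by move/set_mem.
  rewrite /U /= linearD !linearZ; split; first exact: conv.
  by rewrite opprD -!scalerN; exact: conv.
- by move=> a [Wa Wa']; rewrite /U /= linearN opprK.
- move=> a; have /= := sc0 (ext f a) _ nsub.
  move=> /nbhs_ballP[r /= r0 rW]; exists (r / 2); first by rewrite divr_gt0.
  move=> t tr; rewrite /U /= linearZ; apply: rW.
  rewrite /ball /= sub0r normrN (le_lt_trans tr)// ltr_pdivrMr//.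
  by rewrite ltr_pMr// ltr1n.
- move=> r y.
  have cvg0 : (fun x => r *: (f x - f y)) @ y --> (0 : E).
    apply: (@cvg_comp _ _ _ (fun x => f x - f y) (fun e : E => r *: e)
      _ (nbhs (0 : E))).
      apply: (@cvg_comp _ _ _ (fun x => (f x, f y)) (fun z : E * E => z.1 - z.2)
        _ (nbhs (f y, f y))).
        by apply: (@cvg_pair _ _ _ _ (nbhs (f y)) (nbhs (f y)));
          [exact: cf|exact: cvg_cst].
      by have := @sub_continuous E (f y, f y); rewrite /continuous_at /= subrr.
    apply: (@cvg_comp _ _ _ (fun e : E => (r : R^o, e))
      (fun z : R^o * E => z.1 *: z.2) _ (nbhs ((r : R^o), (0 : E)))).
      by apply: (@cvg_pair _ _ _ _ (nbhs (r : R^o)) (nbhs (0 : E)));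
        [exact: cvg_cst|exact: cvg_id].
    by have := @scale_continuous R E (r, 0); rewrite /continuous_at /= scaler0.
  have /= ny := cvg0 _ nsub; apply: (@filterS _ (nbhs y) _ _ _ _ ny) => x.
  have xy : ext f (r *: (fdelta x - fdelta y)) = r *: (f x - f y).
    by rewrite -!(ext_delta f) -linearB -linearZ.
  by rewrite /U /mkset xy.
Qed.

Lemma separating v : tychonoff_space X -> v != 0 ->
  exists2 U, admissible U & ~ U v.
Proof.
move=> [T1 crX] v0.
have [x vx] : exists x, \val v x != 0.
  apply: contrapT => nv; move/eqP: v0; apply; apply/val_inj/funext => x /=.
  by apply: contrapT => /eqP vx; apply: nv; exists x.
have fB : finite_set (supp (\val v) `\ x).
  by apply: sub_finite_set (finite_supp v) => z [].
have clB : closed (supp (\val v) `\ x) by move/accessible_finite_set_closed: (T1); exact.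
have nBx : ~ (supp (\val v) `\ x) x by case=> _; apply.
have /(@uniform_separatorP _ R)[g [cg _ g0 g1]] := crX _ _ clB nBx.
pose f (y : X) : R^o := 1 - g y.
have cf : continuous f.
  by move=> y; apply: cvgB; [exact: cvg_cst|exact: cg].
have extv : ext f v = \val v x.
  rewrite /ext (big_fsetD1 x)/=; last first.
    by rewrite in_fset_set ?inE//; exact: finite_supp.
  rewrite big1_fset ?addr0 => [|y].
    by rewrite /f (_ : g x = 0) ?subr0 ?mulr1// ; [exact: mulr1|apply: g0; exists x].
  rewrite in_fsetD1 in_fset_set; last exact: finite_supp.
  move=> /andP[/eqP yx /set_mem vy] _.
  by rewrite /f (_ : g y = 1) ?subrr ?scaler0//; apply: g1; exists y.
have /(_ 0) := @ext_continuous R^o f cf.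
rewrite /continuous_at linear0 => ec.
have : nbhs (0 : R^o) [set r : R^o | `|r| < `|\val v x|].
  apply/nbhs_ballP; exists `|\val v x| => /=; first by rewrite normr_gt0.
  by move=> r; rewrite /ball /= sub0r normrN.
move=> /ec /= [U aU UN]; exists U => // Uv.
by have /= := UN v; rewrite subr0 extv ltxx => /(_ Uv).
Qed.

Lemma carrier_hausdorff : tychonoff_space X -> hausdorff_space carrier.
Proof.
move=> tX p q pq; apply: contrapT => /eqP; rewrite -subr_eq0 => /(separating tX).
move=> [U aU]; apply.
have aU2 := admissibleZ 2 aU.
have [w [Uw Uw']] := pq _ _ (nbhs_admissible p aU2) (nbhs_admissible q aU2).
rewrite -(subrKA w p); apply: admissible_half => //.
by have [_ sU _ _] := aU; rewrite -opprB scalerN; exact: sU.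
Qed.

Lemma carrier_free : tychonoff_space X -> @is_free_lcs R X carrier fdelta.
Proof.
move=> tX; split.
- exact: carrier_hausdorff.
- exact: fdelta_continuous.
- exact: fdelta_inj.
- move=> v; exists [seq (\val v x, x) | x <- fset_set (supp (\val v))].
  by rewrite big_map; exact: carrier_span.
- move=> E f _ cf; exists (ext f : {linear carrier -> E}) => [|x].
    exact: ext_continuous.
  exact: ext_delta.
Qed.

End carrier.
End FreeLcsExistence.

Lemma freeLcs_exists (R : realType) (X : topologicalType) :
  tychonoff_space X -> inhabited (freeLcs R X).
Proof.
move=> tX; constructor; exact: FreeLcs (FreeLcsExistence.carrier_free R tX).
Qed.

(* Main.v *)
From HB Require Import structures.
Require Import Defs.
From mathcomp Require Import all_boot all_order all_algebra.
From mathcomp Require Import all_classical all_reals all_analysis.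

Set Implicit Arguments.
Unset Strict Implicit.
Unset Printing Implicit Defensive.

Import GRing.Theory.
Import numFieldNormedType.Exports.

Local Open Scope classical_set_scope.
Local Open Scope ring_scope.

(** Write [P1], [P2] for the continuous linear projections of [L(X)] onto
    [L(K1)], [L(K2)] given by the parallel retractions, so that [P1 P2 = P1] and
    [P2 P1 = P2], and let [e] be the augmentation of [L(X)], the continuous
    functional that sends every point of [X] to [1].

    The extension [p_# : L(X) -> L(X/K)] of a collapse [p : X -> X/K] by an
    [L]-retract [K] has a continuous linear section: for [x0] in [K] and [P] the
    projection onto [L(K)], the map [x |-> x - P x + e (P x) x0] is constant on
    [K], so it factors through [X/K] ([collapse_lift]). Hence [L(X/K)] is the
    quotient of [L(X)] by the kernel of [p_#], and the section formula shows that
    this kernel is the hyperplane [e = 0] of [L(K)] ([collapse_kernelP]). It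
    therefore suffices to find a topological automorphism of [L(X)] that maps the
    first kernel onto the second one ([top_iso_split]).

    The automorphism [v |-> v - P1 v + P2 v], with inverse [u |-> u - P2 u + P1 u],
    maps [L(K1)] onto [L(K2)], but it need not respect [e]: it carries the
    hyperplane [e = 0] of [L(K1)] to the hyperplane [e P1 = 0] of [L(K2)]. On
    [L(K2)] both [e] and [e P1] are nonzero, so that they do not vanish at some
    common [w] ([common_nonzero]), and a shear along [w] takes the kernel of
    [e P1] to that of [e]. Composing with this shear gives [exchange]. *)

(** * Continuity in locally convex spaces *)

Section tvs_continuity.
Context (R : realType) (T : topologicalType) (E : tvsType R).

Lemma tvs_continuousD (f g : T -> E) :
  continuous f -> continuous g -> continuous (fun x => f x + g x).
Proof.
move=> cf cg x; apply: (@cvg_comp _ _ _ (fun x => (f x, g x))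
  (fun z : E * E => z.1 + z.2) _ (nbhs (f x, g x))).
  by apply: (@cvg_pair _ _ _ _ (nbhs (f x)) (nbhs (g x))); [exact: cf|exact: cg].
exact: (@add_continuous E (f x, g x)).
Qed.

Lemma tvs_continuousB (f g : T -> E) :
  continuous f -> continuous g -> continuous (fun x => f x - g x).
Proof.
move=> cf cg x; apply: (@cvg_comp _ _ _ (fun x => (f x, g x))
  (fun z : E * E => z.1 - z.2) _ (nbhs (f x, g x))).
  by apply: (@cvg_pair _ _ _ _ (nbhs (f x)) (nbhs (g x))); [exact: cf|exact: cg].
exact: (@sub_continuous E (f x, g x)).
Qed.

Lemma tvs_continuousZl (k : T -> R^o) (w : E) :
  continuous k -> continuous (fun x => k x *: w).
Proof.
move=> ck x; apply: (@cvg_comp _ _ _ (fun x => (k x, w))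
  (fun z : R^o * E => z.1 *: z.2) _ (nbhs (k x, w))).
  by apply: (@cvg_pair _ _ _ _ (nbhs (k x)) (nbhs w)); [exact: ck|exact: cvg_cst].
exact: (@scale_continuous R E (k x, w)).
Qed.

End tvs_continuity.

(** * Exchanging the ranges of two parallel projections *)

Section exchange.
Context (R : realType) (V : tvsType R).
Context (P1 P2 : {linear V -> V}) (e : {linear V -> R^o}) (c : R) (w : V).

(** The composite of [v |-> v - P1 v + P2 v] with the shear
    [u |-> u + (c * e (P1 u) - e (P2 u)) *: w]. *)
Definition exchange (v : V) : V :=
  v - P1 v + P2 v + ((c *: e (P1 v) : R^o) - e (P2 v)) *: w.

Lemma exchange_is_linear : linear exchange.
Proof.
move=> a u v; rewrite /exchange !linearP.
rewrite /= (addrACA (a *: (c *: _))) -scalerDr scalerDl -(scalerA a _ w).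
rewrite (addrACA (a *: u)) -scalerDr.
rewrite (addrACA (a *: (u - P1 u))) -scalerDr.
by rewrite (addrACA (a *: (u - P1 u + P2 u))) -scalerDr.
Qed.

HB.instance Definition _ :=
  GRing.isLinear.Build R V V _ exchange exchange_is_linear.

Lemma exchange_continuous :
  continuous P1 -> continuous P2 -> continuous e -> continuous exchange.
Proof.
move=> c1 c2 ce.
have ceP (P : {linear V -> V}) : continuous P -> continuous (fun v => e (P v)).
  by move=> cP v; apply: continuous_comp; [exact: cP|exact: ce].
apply: tvs_continuousD.
  apply: tvs_continuousD => //; apply: tvs_continuousB => // x; exact: cvg_id.
apply: tvs_continuousZl; apply: tvs_continuousB; last exact: ceP.
move=> v; apply: (@continuous_comp _ _ _ (fun v => e (P1 v)) (fun t => c *: t)).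
  exact: ceP.
exact: scaler_continuous.
Qed.

Hypothesis PP2 : forall v, P2 (P2 v) = P2 v.
Hypothesis Pw : P2 w = w.
Hypothesis ew : e w = 1.

(** On such [v] the functional [e P1] vanishes, so [exchange] reduces to the
    projection onto the range of [P2] followed by the correction along [w] that
    kills [e]. *)
Lemma exchange_kernel v : P1 v = v -> e v = 0 ->
  P2 (exchange v) = exchange v /\ e (exchange v) = 0.
Proof.
move=> Pv ev; have -> : exchange v = P2 v - e (P2 v) *: w.
  by rewrite /exchange Pv ev scaler0 subrr !add0r scaleNr.
split; first by rewrite linearB linearZ /= PP2 Pw.
by rewrite linearB linearZ /= ew [_ *: _]mulr1 subrr.
Qed.

End exchange.

(** The shear pulls [e P2] back to [c *: e P1]. The normalization of [c] makes it
    invertible, and symmetric under the swap of [P1] and [P2]: its inverse moves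
    along [c *: P1 w], on which [e] is again [1]. *)
Lemma exchangeK (R : realType) (V : tvsType R) (P1 P2 : {linear V -> V})
    (e : {linear V -> R^o}) (c : R) (w : V) :
  (forall v, P1 (P1 v) = P1 v) -> (forall v, P2 (P2 v) = P2 v) ->
  (forall v, P1 (P2 v) = P1 v) -> (forall v, P2 (P1 v) = P2 v) ->
  P2 w = w -> e w = 1 -> c * e (P1 w) = 1 ->
  cancel (exchange P1 P2 e c w) (exchange P2 P1 e c^-1 (c *: P1 w)).
Proof.
move=> PP1 PP2 P12 P21 Pw ew cew v.
have c0 : c != 0.
  by apply/eqP => c0; move/eqP: cew; rewrite c0 mul0r eq_sym oner_eq0.
set u := exchange _ _ _ _ _ v; pose k : R^o := c * e (P1 v) - e (P2 v).
have uE : u = v - P1 v + P2 v + k *: w by [].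
have P1u : P1 u = P1 v + k *: P1 w.
  by rewrite uE !(linearD, linearN, linearZ) /= PP1 P12 subrr add0r.
have P2u : P2 u = P2 v + k *: w.
  by rewrite uE !(linearD, linearN, linearZ) /= PP2 P21 Pw subrr add0r.
have eP1w : e (P1 w) = c^-1 by apply: (mulfI c0); rewrite cew mulfV.
have euE : c^-1 * e (P2 u) - e (P1 u) = - (c^-1 * k).
  have -> : e (P1 u) = e (P1 v) + k * c^-1 by rewrite P1u linearD linearZ eP1w.
  have -> : e (P2 u) = c * e (P1 v).
    by rewrite P2u linearD linearZ /= ew [_ *: _]mulr1 addrC subrK.
  by rewrite mulKf// opprD addNKr mulrC.
rewrite /exchange -[c^-1 *: _]/(c^-1 * e (P2 u) : R^o) euE P2u P1u uE.
rewrite scalerA mulNr mulrAC mulVf// mul1r scaleNr.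
by rewrite -(addrA (v - P1 v)) addrK addrA subrK addrK.
Qed.

Section common_nonzero.
Context (R : realType) (V : tvsType R).
Context (P1 P2 : {linear V -> V}) (e : {linear V -> R^o}).

(** The hyperplanes [e = 0] and [e P1 = 0] do not cover the range of [P2]: when
    neither [a2] nor [P2 a1] avoids both of them, their sum does. *)
Lemma common_nonzero (a1 a2 : V) :
  (forall v, P2 (P2 v) = P2 v) -> (forall v, P1 (P2 v) = P1 v) ->
  P1 a1 = a1 -> P2 a2 = a2 -> e a1 = 1 -> e a2 = 1 ->
  exists w, [/\ P2 w = w, e w = 1 & e (P1 w) != 0].
Proof.
move=> PP2 P12 Pa1 Pa2 ea1 ea2.
have [ea20|ea20] := eqVneq (e (P1 a2)) 0; last by exists a2.
have [ea10|ea10] := eqVneq (e (P2 a1)) 0.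
  exists (a2 + P2 a1); rewrite !linearD/= PP2 P12 Pa1 Pa2 ea1 ea2 ea10 ea20.
  by rewrite addr0 add0r oner_eq0.
exists ((e (P2 a1))^-1 *: P2 a1); rewrite !linearZ/= PP2 P12 Pa1 ea1; split=> //.
  exact: mulVf.
by rewrite [_ *: _]mulr1 invr_eq0.
Qed.

End common_nonzero.

Lemma exchange_automorphism (R : realType) (V : tvsType R)
    (P1 P2 : {linear V -> V}) (e : {linear V -> R^o}) (a1 a2 : V) :
  continuous P1 -> continuous P2 -> continuous e ->
  (forall v, P1 (P1 v) = P1 v) -> (forall v, P2 (P2 v) = P2 v) ->
  (forall v, P1 (P2 v) = P1 v) -> (forall v, P2 (P1 v) = P2 v) ->
  P1 a1 = a1 -> P2 a2 = a2 -> e a1 = 1 -> e a2 = 1 ->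
  exists phi phi' : {linear V -> V},
    [/\ continuous phi /\ continuous phi', cancel phi phi', cancel phi' phi,
        forall v, P1 v = v -> e v = 0 -> P2 (phi v) = phi v /\ e (phi v) = 0 &
        forall v, P2 v = v -> e v = 0 -> P1 (phi' v) = phi' v /\ e (phi' v) = 0].
Proof.
move=> cP1 cP2 ce PP1 PP2 P12 P21 Pa1 Pa2 ea1 ea2.
have [w [Pw ew ePw]] := common_nonzero PP2 P12 Pa1 Pa2 ea1 ea2.
have [c cew] : exists c, c * e (P1 w) = 1.
  by exists (e (P1 w))^-1; exact: mulVf.
pose w1 := c *: P1 w.
have Pw1 : P1 w1 = w1 by rewrite /w1 linearZ /= PP1.
have ew1 : e w1 = 1 by rewrite /w1 linearZ.
have P2w1 : P2 w1 = c *: w by rewrite /w1 linearZ /= P21 Pw.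
have c0 : c != 0.
  by apply/eqP => c0; move/eqP: cew; rewrite c0 mul0r eq_sym oner_eq0.
have cew1 : c^-1 * e (P2 w1) = 1.
  by rewrite P2w1 linearZ /= ew [_ *: _]mulr1 mulVf.
have phiK := exchangeK PP1 PP2 P12 P21 Pw ew cew.
have := exchangeK PP2 PP1 P21 P12 Pw1 ew1 cew1.
rewrite P2w1 invrK scalerA mulVf// scale1r => phiK'.
exists (exchange P1 P2 e c w), (exchange P2 P1 e c^-1 w1).
by split=> //; [split; exact: exchange_continuous|exact: exchange_kernel
  |exact: exchange_kernel].
Qed.

(** * Isomorphisms between split quotients *)

Section top_iso_split.
Context (R : realType) (V Y1 Y2 : tvsType R).
Context (p1 : {linear V -> Y1}) (p2 : {linear V -> Y2}).
Context (s1 : {linear Y1 -> V}) (s2 : {linear Y2 -> V}).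
Context (phi phi' : {linear V -> V}).

(** The sections make [Y1] and [Y2] topological quotients of [V] by the kernels
    of [p1] and [p2], so an automorphism matching the kernels descends. *)
Lemma top_iso_split :
  continuous p1 -> continuous p2 -> continuous s1 -> continuous s2 ->
  continuous phi -> continuous phi' ->
  cancel s1 p1 -> cancel s2 p2 -> cancel phi phi' -> cancel phi' phi ->
  (forall v, p1 v = 0 -> p2 (phi v) = 0) ->
  (forall v, p2 v = 0 -> p1 (phi' v) = 0) ->
  exists psi : {linear Y1 -> Y2},
    top_iso psi /\ forall v, psi (p1 v) = p2 (phi v).
Proof.
move=> cp1 cp2 cs1 cs2 cphi cphi' sK1 sK2 phiK phiK' ker12 ker21.
have psiE v : p2 (phi (s1 (p1 v))) = p2 (phi v).
  by apply/eqP; rewrite -subr_eq0 -!linearB ker12// linearB /= sK1 subrr.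
have psiE' v : p1 (phi' (s2 (p2 v))) = p1 (phi' v).
  by apply/eqP; rewrite -subr_eq0 -!linearB ker21// linearB /= sK2 subrr.
exists (p2 \o phi \o s1 : {linear Y1 -> Y2}); split; last exact: psiE.
split.
  move=> y; apply: continuous_comp; first exact: cs1.
  by apply: continuous_comp; [exact: cphi|exact: cp2].
exists (p1 \o phi' \o s2); split=> y /=.
- by rewrite psiE' phiK sK1.
- by rewrite psiE phiK' sK2.
- apply: continuous_comp; first exact: cs2.
  by apply: continuous_comp; [exact: cphi'|exact: cp1].
Qed.

End top_iso_split.

(** * Collapsing an L-retract *)

Lemma augmentation_exists (R : realType) (X : topologicalType)
    (LX : freeLcs R X) :
  exists2 e : {linear LX -> R^o}, continuous e & forall x, e (delta LX x) = 1.
Proof.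
have one_cts : continuous ((fun=> 1) : X -> R^o) by move=> x; exact: cvg_cst.
exact: (free_extension (Defs.freeP LX) (@norm_hausdorff R R^o) one_cts).
Qed.

Section collapse_retract.
Context (R : realType) (X : topologicalType) (K : set X).
Context (LX : freeLcs R X) (LK : freeLcs R K) (LY : freeLcs R (collapse R K)).
Context (e : {linear LX -> R^o}).
Hypothesis ce : continuous e.
Hypothesis e1 : forall x, e (delta LX x) = 1.
Context (r : {linear LX -> LK}).
Hypothesis rP : L_retraction r.

Let P : {linear LX -> LX} := L_incl LX LK \o r.
Let p := lcs_map LX LY (collapse_proj R K).

Lemma L_incl_delta x (Kx : K x) :
  L_incl LX LK (delta LK (SigSub (mem_set Kx))) = delta LX x.
Proof. by rewrite /L_incl lcs_map_delta. Qed.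

Lemma retract_proj_continuous : continuous P.
Proof.
move=> v; apply: continuous_comp; first exact: rP.1.
exact: lcs_map_continuous.
Qed.

Lemma retract_projK v : P (P v) = P v.
Proof. by rewrite /P /= rP.2. Qed.

Lemma retract_proj_delta x : K x -> P (delta LX x) = delta LX x.
Proof. by move=> Kx; rewrite -(L_incl_delta Kx) /P /= rP.2. Qed.

(** On [L(K)], where all points have the same image, only the total coefficient
    survives. *)
Lemma collapse_proj_retract v : p (P v) = e (P v) *: delta LY None.
Proof.
rewrite /P /=; have [s ->] := Defs.free_span (Defs.freeP LK) (r v).
rewrite !linear_sum scaler_suml; apply: eq_bigr => -[a [x Kx]] _.
rewrite !linearZ/= /L_incl lcs_map_delta e1 /p lcs_map_delta.
rewrite [X in delta LY X]collapse_proj_in; last exact: set_mem Kx.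
by rewrite [_ *: 1]mulr1.
Qed.

Lemma collapse_lcs_surj (y : LY) : K !=set0 -> exists v, p v = y.
Proof.
move=> /(@collapse_proj_R_quotient R)[_ surj _].
have [s ->] := Defs.free_span (Defs.freeP LY) y.
elim: s => [|[a z] s [v vE]]; first by exists 0; rewrite big_nil linear0.
have [x <-] := surj z; exists (a *: delta LX x + v).
by rewrite big_cons linearP vE /p lcs_map_delta.
Qed.

(** The right-hand side takes the constant value [x0] at the points of [K]. The
    induced map on [X/K] is continuous because real functions detect continuity
    into the completely regular space [L(X)]. *)
Lemma collapse_lift x0 : K x0 ->
  exists2 s : {linear LY -> LX}, continuous s &
    forall v, s (p v) = v - P v + e (P v) *: delta LX x0.
Proof.
move=> Kx0.
pose h v : LX := v - P v + e (P v) *: delta LX x0.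
have hlin : linear h.
  move=> a u v; rewrite /h !linearP /= scalerDl.
  rewrite -(scalerA a _ (delta LX x0)) (addrACA (a *: u)) -scalerDr.
  by rewrite (addrACA (a *: (u - _))) -scalerDr.
have ch : continuous h.
  apply: tvs_continuousD.
    apply: tvs_continuousB; last exact: retract_proj_continuous.
    by move=> v; exact: cvg_id.
  apply: tvs_continuousZl => v; apply: continuous_comp; last exact: ce.
  exact: retract_proj_continuous.
pose g (y : collapse R K) : LX :=
  if y is Some x then h (delta LX (\val x)) else delta LX x0.
have gE x : g (collapse_proj R K x) = h (delta LX x).
  have [Kx|nKx] := pselect (K x); last first.
    by rewrite (collapse_proj_out R (exist _ x (mem_set nKx))).
  by rewrite collapse_proj_in// /h retract_proj_delta// e1 subrr add0r scale1r.
have cg : continuous g.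
  apply: (@continuous_real_functions R).
    exact: (@uniform_completely_regular R).
  move=> k ck; apply/collapse_functionP => x.
  rewrite (_ : _ \o _ = k \o h \o delta LX); last first.
    by apply/funext => z /=; rewrite gE.
  apply: continuous_comp; first exact: free_delta_continuous (Defs.freeP LX) _.
  by apply: continuous_comp; [exact: ch|exact: ck].
have [s cs sE] := free_extension (Defs.freeP LY) (free_hausdorff (Defs.freeP LX)) cg.
exists s => // v; rewrite -/(h v).
pose H : {linear LX -> LX} := HB.pack h (GRing.isLinear.Build _ _ _ _ h hlin).
rewrite -[h]/(H : LX -> LX); have [l ->] := Defs.free_span (Defs.freeP LX) v.
rewrite !linear_sum; apply: eq_bigr => a _.
by rewrite !linearZ /= /p lcs_map_delta sE gE.
Qed.

Lemma collapse_section : K !=set0 ->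
  exists2 s : {linear LY -> LX}, continuous s & cancel s p.
Proof.
move=> K0; have [x0 Kx0] := K0; have [s cs sE] := collapse_lift Kx0.
exists s => // y; have [v <-] := collapse_lcs_surj y K0.
rewrite sE linearD linearB linearZ /= collapse_proj_retract.
by rewrite /p lcs_map_delta [X in _ + _ *: delta LY X]collapse_proj_in// subrK.
Qed.

(** If [p v = 0], the lift writes [v] as [P v - e (P v) x0], an element of
    [L(K)]; then [P v = v] and the same equation gives [e v = 0]. *)
Lemma collapse_kernelP v : K !=set0 -> p v = 0 <-> P v = v /\ e v = 0.
Proof.
move=> [x0 Kx0]; split=> [pv|[Pv ev]]; last first.
  by rewrite -Pv collapse_proj_retract Pv ev scale0r.
have [s _ /(_ v)] := collapse_lift Kx0; rewrite pv linear0 => /esym vE.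
have Pv : P v = v.
  have : P (v - P v + e (P v) *: delta LX x0) = 0 by rewrite vE linear0.
  rewrite linearD linearB linearZ /= rP.2 subrr add0r.
  rewrite [X in _ *: X](retract_proj_delta Kx0) => e0.
  by move: vE; rewrite e0 addr0 => /eqP; rewrite subr_eq0 eq_sym => /eqP.
split=> //; have := congr1 e vE.
by rewrite Pv subrr add0r linearZ /= e1 linear0 [_ *: _]mulr1.
Qed.

End collapse_retract.

(** * Parallel L-retracts *)

Theorem theorem4p5 (R : realType) (X : topologicalType) (K1 K2 : set X)
    (LX : freeLcs R X) (LK1 : freeLcs R K1) (LK2 : freeLcs R K2)
    (LY1 : freeLcs R (collapse R K1)) (LY2 : freeLcs R (collapse R K2)) :
  tychonoff_space X -> K1 !=set0 -> K2 !=set0 ->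
  parallel_L_retracts LX LK1 LK2 ->
  L_equivalent_maps LX LY1 LX LY2 (collapse_proj R K1) (collapse_proj R K2) /\
  L_equivalent LY1 LY2.
Proof.
move=> _ K10 K20 [_ _ [r1 [r2 [r1P r2P r12 r21]]]].
have [e ce e1] := augmentation_exists LX.
pose P1 : {linear LX -> LX} := L_incl LX LK1 \o r1.
pose P2 : {linear LX -> LX} := L_incl LX LK2 \o r2.
have PP1 v : P1 (P1 v) = P1 v by exact: retract_projK.
have PP2 v : P2 (P2 v) = P2 v by exact: retract_projK.
have P12 v : P1 (P2 v) = P1 v by rewrite /P1 /= r12.
have P21 v : P2 (P1 v) = P2 v by rewrite /P2 /= r21.
have cP1 : continuous P1 by exact: retract_proj_continuous.
have cP2 : continuous P2 by exact: retract_proj_continuous.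
have [[x1 Kx1] [x2 Kx2]] := (K10, K20).
have [phi [phi' [[cphi cphi'] phiK phiK' ker12 ker21]]] :=
  exchange_automorphism cP1 cP2 ce PP1 PP2 P12 P21 (retract_proj_delta r1P Kx1)
    (retract_proj_delta r2P Kx2) (e1 x1) (e1 x2).
have [s1 cs1 s1K] := collapse_section LY1 ce e1 r1P K10.
have [s2 cs2 s2K] := collapse_section LY2 ce e1 r2P K20.
have [||psi [psi_iso psiE]] := top_iso_split (@lcs_map_continuous _ _ _ LX LY1 _)
    (@lcs_map_continuous _ _ _ LX LY2 _) cs1 cs2 cphi cphi' s1K s2K phiK phiK'.
- move=> v /(collapse_kernelP _ ce e1 r1P _ K10)[Pv ev].
  by apply/(collapse_kernelP _ ce e1 r2P _ K20); exact: ker12.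
- move=> v /(collapse_kernelP _ ce e1 r2P _ K20)[Pv ev].
  by apply/(collapse_kernelP _ ce e1 r1P _ K10); exact: ker21.
split; last by exists psi.
by exists phi, psi; split=> //; split=> //; exists phi'.
Qed.
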